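(* Let $\mathcal{R}$ and $\mathcal{S}$ be reduced TRSs (over the same signature) that are normalization equivalent. Then $\mathcal{R}$ and $\mathcal{S}$ are literally similar, i.e. $\mathcal{R}\doteq\mathcal{S}$.
   Context: A TRS is a set of rules $\ell\to r$ between terms over a signature and an infinite set of variables, with $\ell$ not a variable and every variable of $r$ occurring in $\ell$. $\to_{\mathcal{R}}$ is the closure of $\mathcal{R}$ under contexts and substitutions and $\mathrm{NF}(\mathcal{R})$ is the set of terms irreducible with respect to $\to_{\mathcal{R}}$. $s\to_{\mathcal{R}}^!t$ means $s\to_{\mathcal{R}}^*t$ and $t\in\mathrm{NF}(\mathcal{R})$. $\mathcal{R}$ and $\mathcal{S}$ are normalization equivalent if ${\to_{\mathcal{R}}^!}={\to_{\mathcal{S}}^!}$ (no termination or confluence is assumed). $\mathcal{R}$ is left-reduced if $\ell\in\mathrm{NF}(\mathcal{R}\setminus\{\ell\to r\})$ for every $\ell\to r\in\mathcal{R}$, right-reduced if $r\in\mathrm{NF}(\mathcal{R})$ for every $\ell\to r\in\mathcal{R}$, and reduced if it is both. A variant of a rule $\ell\to r$ is a rule $\ell\sigma\to r\sigma$ with $\sigma$ a renaming (bijective substitution from variables to variables). $\mathcal{R}\doteq\mathcal{S}$ (literal similarity) means every rule of $\mathcal{R}$ has a variant in $\mathcal{S}$ and vice versa. *)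

(* Defs.v *)
From Stdlib Require Export Relations.
From mathcomp Require Export all_boot.
From mathcomp Require Export boolp classical_sets cardinality.

Set Implicit Arguments.
Unset Strict Implicit.
Unset Printing Implicit Defensive.

Local Open Scope classical_set_scope.

Record signature := Signature { symbol :> Type; arity : symbol -> nat }.

Section Terms.
Variables (F : signature) (V : Type).

Inductive term : Type :=
| Var (x : V)
| App (f : F) (args : {ffun 'I_(arity f) -> term}).

Fixpoint vars (t : term) : set V :=
  match t with
  | Var x => [set x]
  | App f args => [set x | exists i, vars (args i) x]
  end.

Fixpoint subst (sigma : V -> term) (t : term) : term :=
  match t with
  | Var x => sigma x
  | App f args => App [ffun i => subst sigma (args i)]
  end.

(* One-hole contexts. In [CApp i args C] the hole lies in the [i]-th argument;
   the entry [args i] is a dummy, ignored by [fill]. *)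
Inductive context : Type :=
| Hole
| CApp (f : F) (i : 'I_(arity f)) (args : {ffun 'I_(arity f) -> term})
       (C : context).

Fixpoint fill (C : context) (t : term) : term :=
  match C with
  | Hole => t
  | CApp f i args C' => App [ffun j => if j == i then fill C' t else args j]
  end.

(* The pair [(l, r)] stands for the rule l -> r. *)
Definition rule : Type := (term * term)%type.

Definition is_TRS (R : set rule) : Prop :=
  forall l r, R (l, r) -> (forall x, l <> Var x) /\ vars r `<=` vars l.

Definition rewrite_step (R : set rule) (s t : term) : Prop :=
  exists (C : context) (sigma : V -> term) (l r : term),
    [/\ R (l, r), s = fill C (subst sigma l) & t = fill C (subst sigma r)].

Definition NF (R : set rule) : set term :=
  [set t | ~ exists u, rewrite_step R t u].

Definition normalizes (R : set rule) (s t : term) : Prop :=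
  clos_refl_trans term (rewrite_step R) s t /\ NF R t.

Definition normalization_equivalent (R S : set rule) : Prop :=
  forall s t, normalizes R s t <-> normalizes S s t.

Definition left_reduced (R : set rule) : Prop :=
  forall l r, R (l, r) -> NF (R `\` [set (l, r)]) l.

Definition right_reduced (R : set rule) : Prop :=
  forall l r, R (l, r) -> NF R r.

Definition reduced (R : set rule) : Prop := left_reduced R /\ right_reduced R.

Definition rename (pi : V -> V) : term -> term := subst (fun x => Var (pi x)).

Definition variant_of (rho rho' : rule) : Prop :=
  exists pi : V -> V,
    bijective pi /\ rho' = (rename pi rho.1, rename pi rho.2).

Definition literally_similar (R S : set rule) : Prop :=
  (forall rho, R rho -> exists2 rho', S rho' & variant_of rho rho') /\
  (forall rho, S rho -> exists2 rho', R rho' & variant_of rho rho').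

End Terms.

Arguments Var {F V} x.
Arguments Hole {F V}.

(* Main.v *)
(* Let l -> r be a rule of R. As r is a normal form, l rewrites to r in S as
   well, and its first step uses a rule l' -> r' of S, so that l encompasses l'.
   By the same argument l' encompasses a left-hand side of R, which has to be l
   because R is left-reduced. Terms encompassing each other are variants, so the
   step takes place at the root and yields a renaming of r'; this is already a
   normal form, hence equal to r. *)

Require Import Defs.
From mathcomp Require Import all_boot boolp classical_sets cardinality.
From Stdlib Require Import Eqdep.

Set Implicit Arguments.
Unset Strict Implicit.
Unset Printing Implicit Defensive.

Local Open Scope classical_set_scope.

(** The generated principle gives no induction hypothesis for the arguments, since they are nested
    inside a finite function. *)
Lemma term_ffun_ind (F : signature) (V : Type) (P : term F V -> Prop) :
  (forall x, P (Var x)) ->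
  (forall f (args : {ffun 'I_(arity f) -> term F V}),
     (forall i, P (args i)) -> P (App args)) ->
  forall t, P t.
Proof.
move=> PVar PApp; fix IH 1 => -[x | f args]; first exact: PVar.
by apply: PApp => i; apply: IH.
Qed.

(** The type of [args] depends on [f], so injectivity of the constructor only yields an equality of
    dependent pairs. *)
Lemma App_inj (F : signature) (V : Type) (f : F)
    (args args' : {ffun 'I_(arity f) -> term F V}) :
  App args = App args' -> args = args'.
Proof. by case=> e; apply: inj_pair2 e. Qed.

Lemma eq_in_subst (F : signature) (V : Type) (s s' : V -> term F V) t :
  (forall x, vars t x -> s x = s' x) <-> subst s t = subst s' t.
Proof.
elim/term_ffun_ind: t => [x | f args IH] /=.
  by split=> [-> | e y ->].
split=> [e | /App_inj e x [i xi]].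
  congr App; apply/ffunP => i; rewrite !ffunE.
  by apply/IH => x xi; apply: e; exists i.
by move: x xi; apply/IH; move/ffunP/(_ i): e; rewrite !ffunE.
Qed.

Lemma subst_Var (F : signature) (V : Type) (t : term F V) : subst Var t = t.
Proof.
elim/term_ffun_ind: t => [//| f args IH] /=.
by congr App; apply/ffunP => i; rewrite ffunE.
Qed.

Lemma subst_comp (F : signature) (V : Type) (s s' : V -> term F V) t :
  subst s' (subst s t) = subst (subst s' \o s) t.
Proof.
elim/term_ffun_ind: t => [//| f args IH] /=.
by congr App; apply/ffunP => i; rewrite !ffunE.
Qed.

Lemma finite_vars (F : signature) (V : Type) (t : term F V) :
  finite_set (vars t).
Proof.
elim/term_ffun_ind: t => [x | f args IH] /=; first exact: finite_set1.
have -> : [set x | exists i, vars (args i) x] =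
          \bigcup_(i in setT) vars (args i).
  by apply/seteqP; split=> [x [i xi] | x [i _ xi]]; exists i.
by apply: bigcup_finite => [|i _]; [apply: finite_finset | apply: IH].
Qed.

Fixpoint subst_context (F : signature) (V : Type) (s : V -> term F V)
    (C : context F V) : context F V :=
  match C with
  | Hole => Hole
  | CApp f i args C' =>
      CApp i [ffun j => subst s (args j)] (subst_context s C')
  end.

Lemma subst_fill (F : signature) (V : Type) (s : V -> term F V) C t :
  subst s (fill C t) = fill (subst_context s C) (subst s t).
Proof.
elim: C => [//| f i args C IH] /=.
by congr App; apply/ffunP => j; rewrite !ffunE; case: eqP.
Qed.

Fixpoint comp_context (F : signature) (V : Type) (C D : context F V) :
    context F V :=
  match C with
  | Hole => D
  | CApp f i args C' => CApp i args (comp_context C' D)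
  end.

Lemma fill_fill (F : signature) (V : Type) (C D : context F V) t :
  fill C (fill D t) = fill (comp_context C D) t.
Proof.
elim: C => [//| f i args C IH] /=.
by congr App; apply/ffunP => j; rewrite !ffunE IH.
Qed.

Fixpoint depth (F : signature) (V : Type) (t : term F V) : nat :=
  match t with
  | Var _ => 0
  | App f args => (\max_i depth (args i)).+1
  end.

Lemma leq_depth_subst (F : signature) (V : Type) (s : V -> term F V) t :
  depth t <= depth (subst s t).
Proof.
elim/term_ffun_ind: t => [//| f args IH] /=.
rewrite ltnS; apply/bigmax_leqP => i _; apply: (leq_trans (IH i)).
by apply: (bigmax_sup i) => //; rewrite ffunE.
Qed.

Lemma ltn_depth_CApp (F : signature) (V : Type) (f : F) (i : 'I_(arity f))
    (args : {ffun 'I_(arity f) -> term F V}) C t :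
  depth (fill C t) < depth (fill (CApp i args C) t).
Proof. by rewrite /= ltnS; apply: (bigmax_sup i) => //; rewrite ffunE eqxx. Qed.

Lemma leq_depth_fill (F : signature) (V : Type) (C : context F V) t :
  depth t <= depth (fill C t).
Proof.
elim: C => [//| f i args C IH].
exact: leq_trans IH (ltnW (ltn_depth_CApp _ _ _ _)).
Qed.

Lemma depth_fill_leq (F : signature) (V : Type) (C : context F V) t :
  depth (fill C t) <= depth t -> C = Hole.
Proof.
case: C => [//| f i args C] le_t.
have := leq_ltn_trans (leq_depth_fill C t) (ltn_depth_CApp i args C t).
by rewrite ltnNge le_t.
Qed.

(** Neither instantiation nor a surrounding context decreases [depth], so all depths around the
    cycle from [u] to [v] and back agree, whereas a nonempty context would increase depth
    strictly. *)
Lemma encompass_antisym (F : signature) (V : Type) (C D : context F V) s t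
    (u v : term F V) :
  u = fill C (subst s v) -> v = fill D (subst t u) -> C = Hole /\ D = Hole.
Proof.
move=> uE vE.
have su := leq_depth_subst t u; have sv := leq_depth_subst s v.
have Cv := leq_depth_fill C (subst s v); rewrite -uE in Cv.
have Du := leq_depth_fill D (subst t u); rewrite -vE in Du.
split.
  apply: (@depth_fill_leq _ _ _ (subst s v)); rewrite -uE.
  exact: leq_trans (leq_trans su Du) sv.
apply: (@depth_fill_leq _ _ _ (subst t u)); rewrite -vE.
exact: leq_trans (leq_trans sv Cv) su.
Qed.

(* By induction on [xs]: post-compose with the transposition of [q x] and [p x]. *)
Lemma injection_extends_to_bijection (T : eqType) (xs : seq T) (p : T -> T) :
  {in xs &, injective p} -> exists2 q, bijective q & {in xs, p =1 q}.
Proof.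
elim: xs => [|x xs IH] p_inj; first by exists id => //; exists id.
have [|q q_bij pq] := IH.
  by move=> y z yin zin; apply: p_inj; rewrite inE (yin, zin) orbT.
have [xin | xnotin] := boolP (x \in xs).
  by exists q => // y; rewrite inE => /predU1P[-> | ]; apply: pq.
pose swap z := if z == q x then p x else if z == p x then q x else z.
have swapK : involutive swap.
  move=> z; rewrite /swap; case: (eqVneq z (q x)) => [-> | zq].
    by rewrite eqxx; case: eqVneq.
  case: (eqVneq z (p x)) => [-> | zp]; first by rewrite eqxx.
  by rewrite (negPf zq) (negPf zp).
exists (swap \o q); first by apply: bij_comp => //; exists swap.
move=> y; rewrite inE => /predU1P[-> | yin] /=; first by rewrite /swap eqxx.
have yx : y != x by apply: contraNneq xnotin => <-.
rewrite /swap (inj_eq (bij_inj q_bij)) (negPf yx) -(pq y yin).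
case: eqP => // /p_inj e; move: yx; rewrite e ?eqxx // inE ?eqxx //.
by rewrite yin orbT.
Qed.

(** An instance of an application is never a variable, so [s] must send each variable of [t] to a
    variable; it does so injectively because [s'] recovers the original. As [t] has finitely many
    variables, this injection extends to a bijection. *)
Lemma retractable_subst_is_renaming (F : signature) (V : Type)
    (s s' : V -> term F V) t :
  subst s' (subst s t) = t ->
  exists2 p, bijective p & forall x, vars t x -> s x = Var (p x).
Proof.
rewrite subst_comp -[RHS]subst_Var => /eq_in_subst sK.
(* [{classic V}] equips [V] with the decidable equality that list membership and transpositions
   require. *)
have [xs xsE] := (@finite_seqP {classic V} _).1 (finite_vars t).
have xsP (x : {classic V}) : x \in xs -> vars t x by rewrite xsE.
(* The default [x] is never reached on variables of [t]. *)
pose p (x : {classic V}) : {classic V} := if s x is Var y then y else x.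
have sp x : vars t x -> s x = Var (p x).
  by move=> /sK; rewrite /= /p; case: (s x).
have [|q q_bij pq] := @injection_extends_to_bijection _ xs p.
  move=> x y /xsP xt /xsP yt pxy.
  have := sK _ xt; rewrite /= sp // pxy -sp //.
  by have /= -> := sK _ yt; case.
exists q => // x xt; rewrite sp // pq //.
by move: xt; rewrite xsE.
Qed.

Lemma rewrite_step_subst (F : signature) (V : Type) (R : set (rule F V)) s t u :
  rewrite_step R t u -> rewrite_step R (subst s t) (subst s u).
Proof.
move=> [C [s' [l [r [Rlr -> ->]]]]].
exists (subst_context s C), (subst s \o s'), l, r.
by rewrite !subst_fill !subst_comp.
Qed.

Lemma NF_subst (F : signature) (V : Type) (R : set (rule F V)) s t :
  NF R (subst s t) -> NF R t.
Proof.
by move=> nf [u tu]; apply: nf; exists (subst s u); apply: rewrite_step_subst.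
Qed.

Lemma rewrite_step_rule (F : signature) (V : Type) (R : set (rule F V)) l r :
  R (l, r) -> rewrite_step R l r.
Proof. by move=> Rlr; exists Hole, Var, l, r; rewrite /= !subst_Var. Qed.

Lemma normalizes_rule (F : signature) (V : Type) (R : set (rule F V)) l r :
  right_reduced R -> R (l, r) -> normalizes R l r.
Proof.
move=> Rr Rlr; split; last exact: Rr Rlr.
exact/rt_step/rewrite_step_rule.
Qed.

Lemma normalizes_eq_or_step (F : signature) (V : Type) (R : set (rule F V)) s t :
  normalizes R s t ->
  s = t \/ exists2 u, rewrite_step R s u & normalizes R u t.
Proof.
move=> [st nf]; have st1n := clos_rt_rt1n _ _ _ _ st.
case: st1n nf => [|u v su uv] nf; first by left.
by right; exists u => //; split=> //; apply: clos_rt1n_rt.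
Qed.

Lemma NF_normalizes_eq (F : signature) (V : Type) (R : set (rule F V)) s t :
  NF R s -> normalizes R s t -> s = t.
Proof. by move=> nf /normalizes_eq_or_step[// | [u su _]]; case: nf; exists u. Qed.

(** The [S]-normalization of [l] to [r] cannot be empty: if [l = r], the rule itself would rewrite
    the normal form [r]. *)
Lemma normalizes_rule_step (F : signature) (V : Type) (R S : set (rule F V)) l r :
  right_reduced R -> normalization_equivalent R S -> R (l, r) ->
  exists2 u, rewrite_step S l u & normalizes S u r.
Proof.
move=> Rr RS Rlr.
have /RS/normalizes_eq_or_step[lr | //] := normalizes_rule Rr Rlr.
by case: (Rr _ _ Rlr); exists r; rewrite -{1}lr; apply: rewrite_step_rule.
Qed.

Lemma reduced_rule_variant (F : signature) (V : Type) (R S : set (rule F V)) rho :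
  is_TRS R -> is_TRS S -> reduced R -> right_reduced S ->
  normalization_equivalent R S -> R rho ->
  exists2 rho', S rho' & variant_of rho rho'.
Proof.
case: rho => l r R_trs S_trs [Rl Rr] Sr RS Rlr.
have [u [C [s [l' [r' [Slr lE ->{u}]]]]] norm_r] :=
  normalizes_rule_step Rr RS Rlr.
have SR : normalization_equivalent S R by move=> x y; split=> /RS.
have [_ [D [t [l'' [r'' [Rlr'' l'E _]]]]] _] := normalizes_rule_step Sr SR Slr.
(* Here [l] contains an instance of [l'], which contains an instance of [l'']. A rule other than
   [(l, r)] would thus reduce [l], against left-reducedness. *)
have [E | neq] := pselect ((l'', r'') = (l, r)); last first.
  case: (Rl _ _ Rlr); eexists.
  exists (comp_context C (subst_context s D)), (subst s \o t), l'', r''; split=> //.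
  by rewrite -fill_fill -subst_comp -subst_fill -l'E.
case: E l'E => -> _ l'E.
have [C0 D0] := encompass_antisym lE l'E; move: lE l'E norm_r.
rewrite {}C0 {}D0 /= => lE l'E norm_r.
(* Applying [s] and then [t] fixes [l'], hence each of its variables, and these include those of
   [r']. *)
have tsK : subst t (subst s r') = r'.
  rewrite subst_comp -[RHS]subst_Var; apply/eq_in_subst => x xr'.
  move: (x) ((S_trs _ _ Slr).2 _ xr'); apply/eq_in_subst.
  by rewrite -subst_comp -lE -l'E subst_Var.
(* [subst s r'] has the [S]-normal form [r'] as an instance, so it is itself [S]-normal and can only
   normalize to itself. *)
have rE : subst s r' = r.
  apply: NF_normalizes_eq norm_r; apply: (@NF_subst _ _ _ t).
  by rewrite tsK; apply: Sr Slr.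
(* Symmetrically, [s] undoes [t] on [l], so [t] acts as a renaming [p] there. *)
have [|p p_bij tp] := @retractable_subst_is_renaming _ _ t s l.
  by rewrite -l'E -lE.
exists (l', r') => //; exists p; split=> //=; congr pair.
  by rewrite l'E; apply/eq_in_subst.
(* Now [r'] is [subst t r], and [t] agrees with [p] on the variables of [r] because they occur in
   [l]. *)
rewrite -tsK rE; apply/eq_in_subst => x xr.
exact/tp/(R_trs _ _ Rlr).2.
Qed.

Theorem theorem4p9 (F : signature) (V : Type) (V_infinite : infinite_set [set: V])
    (R S : set (rule F V)) (R_trs : is_TRS R) (S_trs : is_TRS S)
    (R_reduced : reduced R) (S_reduced : reduced S)
    (RS_equiv : normalization_equivalent R S) :
  literally_similar R S.
Proof.
have SR_equiv : normalization_equivalent S R by move=> s t; split=> /RS_equiv.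
split=> rho.
  exact: reduced_rule_variant R_trs S_trs R_reduced S_reduced.2 RS_equiv.
exact: reduced_rule_variant S_trs R_trs S_reduced R_reduced.2 SR_equiv.
Qed.
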